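(* Let $F:[0,\tau]\times L^2(\Omega)\to L^2(\Omega)$ satisfy: there exists $\kappa>0$ such that $\|F(s,\psi_1)-F(s,\psi_2)\|\le\kappa\|\psi_1-\psi_2\|$ for all $s\in[0,\tau]$ and $\psi_1,\psi_2\in L^2(\Omega)$; and there exists $\phi\in L^2(\Omega)$ such that $s\mapsto F(s,\phi)\in L^1(0,\tau;L^2(\Omega))$. Let $g\in L^2(\Omega)$ and let $u\in C([0,\tau];L^2(\Omega))$ be the unique solution of the final value problem $$u_t-\Delta u=F(t,u)+\int_t^\tau u(x,s)\,ds\ \text{ in }\Omega\times(0,\tau),\qquad u=0\ \text{ on }\partial\Omega\times(0,\tau),\qquad u(\cdot,\tau)=g\ \text{ in }\Omega.$$ Let $p,q>0$ and $\kappa_0=\max\{\kappa,1\}$. For $N\in\mathbb{N}$, let $u^N\in C([0,\tau];L^2(\Omega))$ be the unique element satisfying $$u^N(t)=\mathcal{S}_N(\tau-t)g-\int_t^\tau\mathcal{S}_N(s-t)F(s,u^N(s))\,ds-\int_t^\tau\mathcal{S}_N(s-t)\int_s^\tau u^N(\xi)\,d\xi\,ds,\qquad 0\le t\le\tau.$$ Then the following hold: (i) If $u\in L^\infty(0,\tau;\mathbb{G}_{p,\tau})$, then $$\|u(t)-u^N(t)\|\le e^{(1+\kappa_0)(\tau-t)}\,\|u\|_{L^\infty(0,\tau;\mathbb{G}_{p,\tau})}\,\lambda_N^{-p}e^{-\lambda_N t},\qquad 0\le t\le\tau.$$ (ii) If $u\in L^\infty(0,\tau;\mathbb{G}_{0,q+\tau})$,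 then $$\|u(t)-u^N(t)\|\le e^{(1+\kappa_0)(\tau-t)}\,\|u\|_{L^\infty(0,\tau;\mathbb{G}_{0,q+\tau})}\,e^{-(q+t)\lambda_N},\qquad 0\le t\le\tau.$$
   Context: $\Omega\subset\mathbb{R}^d$ ($d\ge1$) is a bounded domain with smooth boundary, $\tau>0$ is fixed; $\langle\cdot,\cdot\rangle$ and $\|\cdot\|$ are the inner product and norm of $L^2(\Omega)$. $0<\lambda_1\le\lambda_2\le\cdots\to\infty$ are the eigenvalues of the Dirichlet problem $-\Delta v=\lambda v$ in $\Omega$, $v=0$ on $\partial\Omega$, with eigenfunctions $\varphi_j\in H^1_0(\Omega)\cap H^2(\Omega)$ forming an orthonormal basis of $L^2(\Omega)$. For $N\in\mathbb{N}$ and $t\in[0,\tau]$, $\mathcal{S}_N(t):L^2(\Omega)\to L^2(\Omega)$ is defined by $\mathcal{S}_N(t)\psi=\sum_{j=1}^N e^{\lambda_j t}\langle\psi,\varphi_j\rangle\varphi_j$. For $a,b\ge0$, the Gevrey space is $\mathbb{G}_{a,b}=\{\psi\in L^2(\Omega):\sum_{j=1}^\infty\lambda_j^{2a}e^{2b\lambda_j}|\langle\psi,\varphi_j\rangle|^2<\infty\}$, a Hilbert space with norm $\|\psi\|_{\mathbb{G}_{a,b}}^2=\sum_{j=1}^\infty\lambda_j^{2a}e^{2b\lambda_j}|\langle\psi,\varphi_j\rangle|^2$. $L^\infty(0,\tau;\mathbb{G}_{a,b})$ carries the usual essential supremum norm. Standing assumption: the final value problem has a unique solution $u\in C([0,\tau];L^2(\Omega))$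 for the exact final value $g$. Its coefficients $u_j(t)=\langle u(t),\varphi_j\rangle$ satisfy, for all $j\in\mathbb{N}$ and $t\in[0,\tau]$, $$u_j(t)=e^{\lambda_j(\tau-t)}\langle g,\varphi_j\rangle-\int_t^\tau e^{\lambda_j(s-t)}\langle F(s,u(s)),\varphi_j\rangle\,ds-\int_t^\tau e^{\lambda_j(s-t)}\int_s^\tau u_j(\xi)\,d\xi\,ds .$$ *)

(* Defs.v *)
From HB Require Import structures.
From mathcomp Require Import all_boot all_order all_algebra.
From mathcomp Require Import all_classical all_reals all_analysis.
From mathcomp Require Import ess_sup_inf.
Set Implicit Arguments.
Unset Strict Implicit.
Unset Printing Implicit Defensive.
Import Order.TTheory GRing.Theory Num.Theory.
Import numFieldNormedType.Exports.
Local Open Scope classical_set_scope.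
Local Open Scope ring_scope.

Definition rV_display : measure_display -> measure_display.
Proof. exact. Qed.

(** Borel sigma-algebra of R^n, as the one generated by the coordinate
    functions; it contains the open sets by [rV_open_measurable]. *)
Section rV_measurable.
Context {R : realType} (n : nat).

Definition rV_coord (i : 'I_n) (x : 'rV[R]_n) : R := x ord0 i.

Let rV_set0 : g_sigma_preimage rV_coord set0.
Proof. exact: sigma_algebra0. Qed.

Let rV_setC A : g_sigma_preimage rV_coord A -> g_sigma_preimage rV_coord (~` A).
Proof. exact: sigma_algebraC. Qed.

Let rV_bigcup (F : _^nat) : (forall i, g_sigma_preimage rV_coord (F i)) ->
  g_sigma_preimage rV_coord (\bigcup_i (F i)).
Proof. exact: sigma_algebra_bigcup. Qed.

HB.instance Definition _ := @isMeasurable.Build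
  (rV_display default_measure_display) 'rV[R]_n
  (g_sigma_preimage rV_coord) rV_set0 rV_setC rV_bigcup.

Lemma measurable_rV_coord (i : 'I_n) :
  measurable_fun [set: 'rV[R]_n] (rV_coord i).
Proof.
move=> _ Y mY; rewrite setTI; apply: sub_sigma_algebra => /=.
rewrite -bigcup_seq/=; exists i => /=; first by rewrite mem_index_enum.
by exists Y => //; rewrite setTI.
Qed.

Lemma measurable_fun_rV d (T : measurableType d) (f : T -> 'rV[R]_n) :
  (forall i, measurable_fun [set: T] (rV_coord i \o f)) ->
  measurable_fun [set: T] f.
Proof.
move=> mf _ A mA.
suff : measurable `<=` image_set_system [set: T] f measurable by apply.
apply: smallest_sub.
- exact/sigma_algebra_image/sigma_algebra_measurable.
- rewrite -bigcup_seq; apply: bigcup_sub => i _ B [C mC <-].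
  rewrite /image_set_system /= !setTI.
  by have := mf i measurableT C mC; rewrite setTI.
Qed.

Lemma rV_open_measurable (U : set 'rV[R]_n) : open U -> measurable U.
Proof.
move=> oU.
pose B (qk : 'rV[rat]_n * nat) : set 'rV[R]_n :=
  \big[setI/setT]_(i < n)
     (rV_coord i @^-1` `]ratr (qk.1 ord0 i) - qk.2.+1%:R^-1,
                         ratr (qk.1 ord0 i) + qk.2.+1%:R^-1[).
have mB qk : measurable (B qk).
  apply: bigsetI_measurable => i _.
  by rewrite -[X in measurable X]setTI; exact: measurable_rV_coord.
have -> : U = \bigcup_(qk in [set qk | B qk `<=` U]) B qk.
  apply/seteqP; split => [x Ux|x [qk] /= + Bx]; last exact.
  have /nbhs_ballP[e /= e0 eU] : nbhs x U by exact: open_nbhs_nbhs.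
  have e20 : 0 < e / 2 by rewrite divr_gt0.
  have [k ke] : exists k : nat, k.+1%:R^-1 < e / 2.
    have [k _ /(_ k (leqnn _))] := near_infty_natSinv_lt (PosNum e20).
    by exists k.
  have /choice[q qx] (i : 'I_n) : exists q : rat,
      `|x ord0 i - ratr q| < k.+1%:R^-1.
    have /rat_in_itvoo[q] : x ord0 i - k.+1%:R^-1 < x ord0 i + k.+1%:R^-1.
      by rewrite ltrD2l gtrN ?invr_gt0.
    by rewrite in_itv /= => qP; exists q; rewrite distrC ltr_distl.
  exists (\row_i q i, k) => /=.
  - move=> y; rewrite /B -bigcap_seq => Hy; apply: eU; split => // j i.
    rewrite ord1; have := Hy i (mem_index_enum i).
    rewrite /= in_itv /= mxE => /andP[h1 h2].
    rewrite /ball /= (splitr e); apply: (le_lt_trans (ler_distD (ratr (q i)) _ _)).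
    rewrite ltrD//; first exact: (lt_trans (qx i)).
    apply: lt_trans ke; rewrite distrC ltr_distl /rV_coord in h1 h2 *.
    by rewrite h1 h2.
  - rewrite /B -bigcap_seq => i _ /=; rewrite in_itv /= mxE.
    by have := qx i; rewrite ltr_distl.
rewrite bigcup_mkcond; apply: countable_bigcupT_measurable => [|qk].
  exact: countableP.
by case: ifP.
Qed.

End rV_measurable.

Section rV_lebesgue_step.
Context {R : realType} (n : nat).

Definition rV_cons (p : R * 'rV[R]_n) : 'rV[R]_n.+1 :=
  row_mx (const_mx p.1 : 'rV_1) p.2.

Let rV_uncons (x : 'rV[R]_n.+1) : R * 'rV[R]_n :=
  (x ord0 ord0, rsubmx (x : 'rV_(1 + n))).

Let rV_consK : cancel rV_cons rV_uncons.
Proof.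
case=> a x; rewrite /rV_uncons /rV_cons row_mxKr; congr pair.
have -> : @ord0 n = lshift n (@ord0 0) by exact/val_inj.
by rewrite (@row_mxEl R 1 1 n) mxE.
Qed.

Lemma measurable_rV_cons : measurable_fun [set: R * 'rV[R]_n] rV_cons.
Proof.
apply: measurable_fun_rV => i.
case: (@splitP 1 n i) => j ij.
- rewrite (_ : _ \o _ = fst) //; apply/funext => -[a x] /=.
  rewrite /rV_coord /rV_cons (_ : i = lshift n j) ?(@row_mxEl R 1 1 n) ?mxE//.
  exact/val_inj.
- rewrite (_ : _ \o _ = rV_coord j \o snd); last first.
    apply/funext => -[a x] /=.
    rewrite /rV_coord /rV_cons (_ : i = rshift 1 j) ?(@row_mxEr R 1 1 n)//.
    exact/val_inj.
  by apply: measurableT_comp => //; exact: measurable_rV_coord.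
Qed.

Let measurable_rV_uncons : measurable_fun [set: 'rV[R]_n.+1] rV_uncons.
Proof.
apply/measurable_fun_pairP; split => /=.
  exact: measurable_rV_coord.
apply: measurable_fun_rV => i.
rewrite (_ : _ \o _ = rV_coord (rshift 1 i : 'I_n.+1)).
  exact: measurable_rV_coord.
by apply/funext => x; rewrite /rV_coord /= mxE.
Qed.

Variable mu : {sigma_finite_measure set 'rV[R]_n -> \bar R}.

Definition rV_lebesgue_step : set 'rV[R]_n.+1 -> \bar R :=
  pushforward (lebesgue_measure \x mu)%E rV_cons.

Let step0 : rV_lebesgue_step set0 = 0%E.
Proof. by rewrite /rV_lebesgue_step /pushforward preimage_set0 measure0. Qed.

Let step_ge0 A : (0 <= rV_lebesgue_step A)%E.
Proof.
exact: (@measure_ge0 _ _ _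
  (measure_function_pushforward__canonical__measure_function_Measure
     (lebesgue_measure \x mu)%E measurable_rV_cons)).
Qed.

Let step_sigma_additive : semi_sigma_additive rV_lebesgue_step.
Proof.
exact: (@measure_semi_sigma_additive _ _ _
  (measure_function_pushforward__canonical__measure_function_Measure
     (lebesgue_measure \x mu)%E measurable_rV_cons)).
Qed.

HB.instance Definition _ := isMeasure.Build _ _ _ rV_lebesgue_step
  step0 step_ge0 step_sigma_additive.

Let step_sigma_finite : sigma_finite [set: 'rV[R]_n.+1] rV_lebesgue_step.
Proof.
have /sigma_finiteP[F [TF ndF Foo]] := sigma_finiteT (@lebesgue_measure R).
have /sigma_finiteP[G [TG ndG Goo]] := sigma_finiteT mu.
exists (fun k => rV_uncons @^-1` (F k `*` G k)).
  apply/seteqP; split => // x _.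
  have [k _ Fk] : (\bigcup_k F k) (rV_uncons x).1 by rewrite -TF.
  have [l _ Gl] : (\bigcup_k G k) (rV_uncons x).2 by rewrite -TG.
  exists (maxn k l) => //; split => /=.
  - by move: Fk; exact/subsetPset/ndF/leq_maxl.
  - by move: Gl; exact/subsetPset/ndG/leq_maxr.
move=> k; have [mF Fk] := Foo k; have [mG Gk] := Goo k; split.
  rewrite -[X in measurable X]setTI; apply: measurable_rV_uncons => //.
  exact: measurableX.
rewrite /rV_lebesgue_step /pushforward -comp_preimage.
rewrite (_ : _ \o _ = id); last by apply/funext => p; exact: rV_consK.
rewrite preimage_id product_measure1E//.
by rewrite lte_mul_pinfty// ge0_fin_numE.
Qed.

HB.instance Definition _ := Measure_isSigmaFinite.Build _ _ _ rV_lebesgue_step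
  step_sigma_finite.

End rV_lebesgue_step.

Fixpoint rV_lebesgue (R : realType) (n : nat) :
    {sigma_finite_measure set 'rV[R]_n -> \bar R} :=
  match n with
  | 0 => dirac (0 : 'rV[R]_0)
  | n.+1 => rV_lebesgue_step (rV_lebesgue R n)
  end.

Section Sobolev.
Context {R : realType} {d : nat}.

Definition partial (i : 'I_d) (f : 'rV[R]_d -> R) : 'rV[R]_d -> R :=
  fun x => 'D_(delta_mx ord0 i) f x.

Definition iter_partial (s : seq 'I_d) (f : 'rV[R]_d -> R) : 'rV[R]_d -> R :=
  foldr partial f s.

Definition smooth (f : 'rV[R]_d -> R) : Prop :=
  forall s : seq 'I_d, continuous (iter_partial s f) /\
    forall i x, derivable (iter_partial s f) x (delta_mx ord0 i).

(** Near each boundary point, [A] is the sublevel set of a smooth function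
    with nonvanishing gradient. *)
Definition smooth_boundary (A : set 'rV[R]_d) : Prop :=
  forall x, closure A x -> ~ interior A x ->
    exists (rho : 'rV[R]_d -> R),
      [/\ smooth rho, exists i, partial i rho x != 0 &
          \forall y \near x, A y <-> rho y < 0].

Record smooth_domain := SmoothDomain {
  dom_set :> set 'rV[R]_d;
  dom_open : open dom_set;
  dom_connected : connected dom_set;
  dom_nonempty : dom_set !=set0;
  dom_bounded : bounded_set dom_set;
  dom_smooth : smooth_boundary dom_set }.

Variable Omega : smooth_domain.

Definition dom_measure : {measure set 'rV[R]_d -> \bar R} :=
  mrestr (rV_lebesgue R d) (rV_open_measurable (@dom_open Omega)).

(** Elements of [L2] are representatives: square-integrable functions, with
    the pointwise vector space structure of [LfunType].  Equality in
    L^2(Omega) is [L2norm (f - g) = 0]. *)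
Definition L2 := LfunType dom_measure (lee1n 2).

Definition dot (f g : L2) : R := \int[dom_measure]_x (f x * g x).

Definition L2norm (f : L2) : R := fine ('N[dom_measure]_2%:E[EFin \o f])%E.

Definition test_function (eta : 'rV[R]_d -> R) : Prop :=
  smooth eta /\ exists K : set 'rV[R]_d,
    [/\ compact K, K `<=` Omega & forall x, ~ K x -> eta x = 0].

Definition weak_partial (i : 'I_d) (f g : L2) : Prop :=
  forall eta, test_function eta ->
    \int[dom_measure]_x (f x * partial i eta x) =
    - \int[dom_measure]_x (g x * eta x).

(** H^1_0 is the closure of the test functions in H^1. *)
Definition H10 (f : L2) : Prop :=
  exists (G : 'I_d -> L2) (eta : nat -> 'rV[R]_d -> R),
    [/\ forall i, weak_partial i f (G i),
        forall k, test_function (eta k),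
        'N[dom_measure]_2%:E[(fun x => (eta k x - f x)%:E)]%E
          @[k --> \oo] --> 0%E &
        forall i, 'N[dom_measure]_2%:E[(fun x =>
            (partial i (eta k) x - G i x)%:E)]%E @[k --> \oo] --> 0%E].

(** [f] is in H^2 and its Laplacian is [w]. *)
Definition H2_laplacian (f w : L2) : Prop :=
  exists (G : 'I_d -> L2) (H : 'I_d -> 'I_d -> L2),
    [/\ forall i, weak_partial i f (G i),
        forall i j, weak_partial j (G i) (H i j) &
        L2norm (w - \sum_i H i i) = 0].

(** Eigenvalues (with multiplicity) and eigenfunctions of the Dirichlet
    Laplacian, indexed from 1: the values at index 0 are irrelevant.  Every
    eigenvalue is listed, because the eigenfunctions form a basis. *)
Record dirichlet_eigensystem (lam : nat -> R) (phi : nat -> L2) : Prop := {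
  eigen_gt0 : 0 < lam 1;
  eigen_nondecreasing : forall j k, (1 <= j <= k)%N -> lam j <= lam k;
  eigen_cvg : lam j @[j --> \oo] --> +oo;
  eigen_H10 : forall j, (1 <= j)%N -> H10 (phi j);
  eigen_laplacian : forall j, (1 <= j)%N ->
    H2_laplacian (phi j) (- (lam j *: phi j));
  eigen_orthonormal : forall j k, (1 <= j)%N -> (1 <= k)%N ->
    dot (phi j) (phi k) = (j == k)%:R;
  eigen_basis : forall f : L2,
    L2norm (f - \sum_(1 <= j < n.+1) dot f (phi j) *: phi j)
      @[n --> \oo] --> 0 }.

End Sobolev.

Section Bochner.
Context {R : realType}.

Definition itv_measure (a b : R) : {measure set (measurableTypeR R) -> \bar R} :=
  mrestr lebesgue_measure (measurable_itv `[a, b]).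

(** [nrm] is an extended norm on [E], finite on the subspace in which the
    functions take their values. *)
Variables (E : lmodType R) (nrm : E -> \bar R) (a b : R).

Record simple := Simple {
  simple_size : nat;
  simple_set : 'I_simple_size -> set (measurableTypeR R);
  simple_val : 'I_simple_size -> E;
  simple_measurable : forall i, measurable (simple_set i);
  simple_finite : forall i, (nrm (simple_val i) < +oo)%E }.

Definition simple_fun (s : simple) (t : R) : E :=
  \sum_i \1_(simple_set (s := s) i) t *: simple_val i.

Definition simple_integral (s : simple) : E :=
  \sum_i fine (itv_measure a b (simple_set (s := s) i)) *: simple_val i.

Definition simple_cvg_ae (s : nat -> simple) (f : R -> E) : Prop :=
  {ae itv_measure a b, forall t,
     nrm (f t - simple_fun (s k) t) @[k --> \oo] --> 0%E}.

Definition strongly_measurable (f : R -> E) : Prop :=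
  exists s : nat -> simple, simple_cvg_ae s f.

Definition is_bochner_integral (f : R -> E) (v : E) : Prop :=
  exists s : nat -> simple,
    [/\ simple_cvg_ae s f,
        (\int[itv_measure a b]_t nrm (f t - simple_fun (s k) t))%E
          @[k --> \oo] --> 0%E &
        nrm (simple_integral (s k) - v) @[k --> \oo] --> 0%E].

Definition bochner_integrable (f : R -> E) : Prop :=
  exists v, is_bochner_integral f v.

(** Meaningful for integrable [f], and then unique up to [nrm]-distance 0. *)
Definition bochner_integral (f : R -> E) : E :=
  xget 0 [set v | is_bochner_integral f v].

End Bochner.

Section Problem.
Context {R : realType} {d : nat} (Omega : @smooth_domain R d) (tau : R).
Local Notation E := (L2 Omega).

Definition L2integrable (a b : R) (f : R -> E) : Prop :=
  bochner_integrable (fun v : E => (L2norm v)%:E) a b f.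

Definition L2integral (a b : R) (f : R -> E) : E :=
  bochner_integral (fun v : E => (L2norm v)%:E) a b f.

Definition continuous_L2 (u : R -> E) : Prop :=
  forall t, t \in `[0, tau] ->
    L2norm (u s - u t) @[s --> within [set` `[0, tau]] (nbhs t)] --> 0.

(** Lipschitz continuity in L^2 makes [F s] compatible with equality in
    L^2(Omega). *)
Definition lipschitz_source (kappa : R) (F : R -> E -> E) : Prop :=
  forall s, s \in `[0, tau] -> forall psi1 psi2 : E,
    L2norm (F s psi1 - F s psi2) <= kappa * L2norm (psi1 - psi2).

(** Solutions in C([0,tau]; L^2(Omega)) of the final value problem, in the
    very weak sense: the equation is tested against v in H^1_0 and H^2 (the
    Laplacian and the boundary condition being moved onto v by Green's
    formula) and integrated over [t, tau], using u(tau) = g. *)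
Definition fvp_solution (F : R -> E -> E) (g : E) (u : R -> E) : Prop :=
  [/\ continuous_L2 u,
      L2integrable 0 tau (fun s => F s (u s)),
      L2norm (u tau - g) = 0 &
      forall v w, H10 v -> H2_laplacian v w -> forall t, t \in `[0, tau] ->
        dot (u t) v = dot g v
          - \int[lebesgue_measure]_(s in `[t, tau])
              (dot (u s) w + dot (F s (u s)) v
               + dot (L2integral s tau u) v)].

Definition fvp_unique_solution (F : R -> E -> E) (g : E) (u : R -> E) : Prop :=
  fvp_solution F g u /\
  forall w, fvp_solution F g w ->
    forall t, t \in `[0, tau] -> L2norm (w t - u t) = 0.

Variables (lam : nat -> R) (phi : nat -> E).

Definition coefficient_formula (F : R -> E -> E) (g : E) (u : R -> E) : Prop :=
  forall j t, (1 <= j)%N -> t \in `[0, tau] ->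
    dot (u t) (phi j) =
      expR (lam j * (tau - t)) * dot g (phi j)
      - \int[lebesgue_measure]_(s in `[t, tau])
          (expR (lam j * (s - t)) * dot (F s (u s)) (phi j))
      - \int[lebesgue_measure]_(s in `[t, tau])
          (expR (lam j * (s - t)) *
           \int[lebesgue_measure]_(xi in `[s, tau]) dot (u xi) (phi j)).

Definition truncated_semigroup (N : nat) (t : R) (psi : E) : E :=
  \sum_(1 <= j < N.+1) (expR (lam j * t) * dot psi (phi j)) *: phi j.

(** The first three clauses say that the integrals in the equation exist. *)
Definition truncated_solution (F : R -> E -> E) (g : E) (N : nat)
    (uN : R -> E) : Prop :=
  let S := truncated_semigroup N in
  continuous_L2 uN /\
  forall t, t \in `[0, tau] ->
    [/\ L2integrable t tau (fun s => S (s - t) (F s (uN s))),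
        L2integrable t tau uN,
        L2integrable t tau (fun s => S (s - t) (L2integral s tau uN)) &
        L2norm (uN t -
          (S (tau - t) g
           - L2integral t tau (fun s => S (s - t) (F s (uN s)))
           - L2integral t tau (fun s => S (s - t) (L2integral s tau uN)))) = 0].

Definition gevrey_norm (a b : R) (psi : E) : \bar R :=
  ((\sum_(1 <= j <oo)
      (lam j `^ (2 * a) * expR (2 * b * lam j) * `|dot psi (phi j)| ^+ 2)%:E)
     `^ 2^-1)%E.

Definition Linfty_gevrey_norm (a b : R) (u : R -> E) : \bar R :=
  ess_sup (itv_measure 0 tau) (fun t => gevrey_norm a b (u t)).

Definition Linfty_gevrey (a b : R) (u : R -> E) : Prop :=
  strongly_measurable (gevrey_norm a b) 0 tau u /\
  (Linfty_gevrey_norm a b u < +oo)%E.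

End Problem.

(* Main.v *)
Require Import Defs.
From mathcomp Require Import all_boot all_order all_algebra.
From mathcomp Require Import all_classical all_reals all_analysis.
From mathcomp Require Import measurable_realfun ess_sup_inf ring lra.
Set Implicit Arguments.
Unset Strict Implicit.
Unset Printing Implicit Defensive.
Import Order.TTheory GRing.Theory Num.Theory.
Import numFieldNormedType.Exports.
Local Open Scope classical_set_scope.
Local Open Scope ring_scope.
(** Put [e = u - uN], [w t = e^(lam_N t) |e t|], [kappa0 = max kappa 1] and
    [L = 1 + kappa0].  Both cases are the case [tau <= b] of the Gevrey class
    G_(a,b).  The modes of [e] above [N] are those of [u], and the Gevrey norm of
    [u t] bounds them by a tail term contributing at most [B] to [w t].  The modes
    up to [N] satisfy the difference of the two integral equations, where the
    amplification e^(lam_j (s - t)) is at most e^(lam_N (s - t)), so it is absorbed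
    by the weight.  Instead of iterating Gronwall's inequality, let [m] be the
    maximum over [0, tau] of [w t e^(-L (tau - t))]; inserting
    [w s <= m e^(L (tau - s))] in the integrals gives
    [w t <= B + m (e^(L (tau - t)) - 1)], first for almost every [t] and then
    for all [t] by continuity.  At a point where the maximum is attained this reads
    [m <= B]. *)

(** * Inner product and norm of L^2(Omega) on representatives *)

Section L2_geometry.
Context {R : realType} {d : nat} {Omega : @smooth_domain R d}.
Local Notation E := (L2 Omega).
Local Notation mu := (dom_measure Omega).
Implicit Types f g h : E.

Lemma integrable_dot f g : mu.-integrable setT (EFin \o (fun x => f x * g x)).
Proof. by apply/Lfun1_integrable/Lfun2_mul_Lfun1; exact: LfunP. Qed.

Lemma dotC f g : dot f g = dot g f.
Proof. by apply: eq_Rintegral => x _; rewrite mulrC. Qed.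

Lemma dotDl f g h : dot (f + g) h = dot f h + dot g h.
Proof.
rewrite /dot -RintegralD//; [|exact: integrable_dot..].
by apply: eq_Rintegral => x _; rewrite mulrDl.
Qed.

Lemma dotZl (k : R) f g : dot (k *: f) g = k * dot f g.
Proof.
rewrite /dot -RintegralZl//; last exact: integrable_dot.
by apply: eq_Rintegral => x _; rewrite mulrA.
Qed.

Lemma dotNl f g : dot (- f) g = - dot f g.
Proof. by rewrite -scaleN1r dotZl mulN1r. Qed.

Lemma dotBl f g h : dot (f - g) h = dot f h - dot g h.
Proof. by rewrite dotDl dotNl. Qed.

Lemma dot0l f : dot 0 f = 0.
Proof. by rewrite -(scale0r 0) dotZl mul0r. Qed.

Lemma dotBr f g h : dot h (f - g) = dot h f - dot h g.
Proof. by rewrite !(dotC h) dotBl. Qed.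

Lemma dotZr (k : R) f g : dot g (k *: f) = k * dot g f.
Proof. by rewrite !(dotC g) dotZl. Qed.

Lemma dot_suml I (s : seq I) (P : pred I) (G : I -> E) f :
  dot (\sum_(i <- s | P i) G i) f = \sum_(i <- s | P i) dot (G i) f.
Proof. by elim/big_rec2: _ => [|i x y _ <-]; rewrite ?dotDl ?dot0l. Qed.

Lemma dot_sumr I (s : seq I) (P : pred I) (G : I -> E) f :
  dot f (\sum_(i <- s | P i) G i) = \sum_(i <- s | P i) dot f (G i).
Proof. by rewrite dotC dot_suml; apply: eq_bigr => i _; rewrite dotC. Qed.

Lemma L2norm_ge0 f : 0 <= L2norm f.
Proof. by rewrite fine_ge0// Lnorm_ge0. Qed.

Lemma sqr_L2norm f : L2norm f ^+ 2 = dot f f.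
Proof.
apply: EFin_inj; rewrite -powR_mulrn ?L2norm_ge0//.
rewrite -poweR_EFin finite_norm_fine powR_Lnorm// /dot /Rintegral fineK//.
  by apply: eq_integral => x _; rewrite /= powR_mulrn// real_normK// num_real.
exact/integrable_fin_num/integrable_dot.
Qed.

(** Cauchy-Schwarz, as Hölder's inequality with both exponents equal to 2. *)
Lemma dot_norm_le f g : `|dot f g| <= L2norm f * L2norm g.
Proof.
rewrite (le_trans (le_normr_Rintegral _ (integrable_dot f g)))//.
rewrite -lee_fin EFinM !finite_norm_fine /Rintegral.
rewrite fineK; last first.
  by apply: integrable_fin_num => //; exact/integrable_norm/integrable_dot.
have := @hoelder _ _ _ mu (f : _ -> R) (g : _ -> R) 2 2.
by rewrite Lnorm1; apply => //; rewrite [RHS]splitr !div1r.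
Qed.

Lemma L2norm_triangle f g : L2norm (f + g) <= L2norm f + L2norm g.
Proof. exact: ler_LnormD. Qed.

Lemma L2normN f : L2norm (- f) = L2norm f.
Proof.
by apply/eqP; rewrite -(@eqrXn2 _ 2) ?L2norm_ge0// !sqr_L2norm dotNl dotC dotNl opprK.
Qed.

Lemma L2norm_distrC f g : L2norm (f - g) = L2norm (g - f).
Proof. by rewrite -L2normN opprB. Qed.

Lemma L2norm_dist_le f g : `|L2norm f - L2norm g| <= L2norm (f - g).
Proof.
have H (x y : E) : L2norm x - L2norm y <= L2norm (x - y).
  by rewrite lerBlDr; have := L2norm_triangle (x - y) y; rewrite subrK.
by rewrite ler_norml H andbT lerNl opprB L2norm_distrC H.
Qed.

(** Equations in L^2(Omega) are stated as vanishing norms of differences; this carries them over to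
    coefficients. *)
Lemma L2norm_eq0_dot f g : L2norm f = 0 -> dot f g = 0.
Proof.
move=> f0; apply/eqP; rewrite -normr_le0.
by rewrite (le_trans (dot_norm_le _ _))// f0 mul0r.
Qed.

End L2_geometry.

(** * Almost everywhere comparison of integrals without measurability *)

Section ae_lower_integral.
Local Open Scope ereal_scope.
Context d (T : measurableType d) (R : realType).
Variable mu : {measure set T -> \bar R}.
Import HBNNSimple.

(* The integral of a nonnegative function is a supremum over simple functions
   below it, so no measurability is needed. *)
Lemma ge0_ae_le_lower_integral (D : set T) (f g : T -> \bar R) :
  (forall x, D x -> 0 <= f x) -> (forall x, D x -> 0 <= g x) ->
  {ae mu, forall x, D x -> f x <= g x} ->
  \int[mu]_(x in D) f x <= \int[mu]_(x in D) g x.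
Proof.
move=> f0 g0 [N [mN N0 fgN]].
rewrite !ge0_integralE//; apply: ge_ereal_sup => _ [h /= hf <-].
have mCN : measurable (~` N) by exact: measurableC.
(* Cutting the simple function [h] to 0 on the exceptional set [N] puts it below [g] everywhere and
   leaves its integral unchanged. *)
apply: le_ereal_sup_tmp; exists (sintegral mu (proj_nnsfun h mCN)).
  exists (proj_nnsfun h mCN) => // x /=.
  rewrite mindicE in_setC; have [xN|xN] := boolP (x \in N).
    by rewrite mulr0; exact: erestrict_ge0.
  rewrite mulr1 (le_trans (hf x))// !patchE.
  case: ifPn => // /set_mem xD.
  apply: contrapT => nfg; move/negP : xN; apply; apply/mem_set/fgN => /=.
  by move=> /(_ xD).
rewrite -!integralT_nnsfun le_eqVlt; apply/orP; left; apply/eqP.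
apply: ge0_ae_eq_integral => //; [exact/measurable_EFinP..| | |].
- by move=> x _; rewrite lee_fin.
- by move=> x _; rewrite lee_fin.
exists N; split => // x /= hx; apply: contrapT => xN; apply: hx => _.
by rewrite /= mindicE in_setC (memNset xN) mulr1.
Qed.

Lemma ae_eq_lower_integral (D : set T) (f g : T -> \bar R) :
  ae_eq mu D f g -> \int[mu]_(x in D) f x = \int[mu]_(x in D) g x.
Proof.
have H (f1 g1 : T -> \bar R) : (forall x, 0 <= f1 x) -> (forall x, 0 <= g1 x) ->
    ae_eq mu D f1 g1 -> \int[mu]_(x in D) f1 x = \int[mu]_(x in D) g1 x.
  move=> f0 g0 fg; apply/eqP; rewrite eq_le; apply/andP.
  by split; apply: ge0_ae_le_lower_integral => //;
    apply: filterS fg => x + Dx => /(_ Dx) ->.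
move=> /ae_eq_funeposneg[Dp Dn]; rewrite integralE [RHS]integralE.
by congr (_ - _); apply: H.
Qed.

End ae_lower_integral.

(** * Integrals over segments of functions known up to null sets *)

Section ae_integral.
Context {R : realType}.
Local Notation leb := (@lebesgue_measure R).
Implicit Types (a b I J k : R) (f g h : R -> R).

(* The integrands obtained from Bochner integrals are only almost everywhere equal
   to Borel functions, and need not be Borel measurable themselves. *)
Definition ae_integral a b f I : Prop := exists h,
  [/\ leb.-integrable `[a, b] (EFin \o h), ae_eq leb `[a, b]%classic f h &
      \int[leb]_(x in `[a, b]) h x = I].

(** The integral of [f] is a difference of suprema over simple functions below its positive and
    negative parts, and neither changes when [f] is replaced by [h]. *)
Lemma ae_integralE a b f I : ae_integral a b f I ->
  \int[leb]_(x in `[a, b]) f x = I.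
Proof.
move=> [h [ih fh <-]]; rewrite /Rintegral; congr fine.
by apply: ae_eq_lower_integral; apply: filterS fh => x + Dx => /(_ Dx) /= ->.
Qed.

Lemma ae_integral_unique a b f I J :
  ae_integral a b f I -> ae_integral a b f J -> I = J.
Proof. by move=> /ae_integralE <- /ae_integralE <-. Qed.

Lemma eq_ae_integral a b f g I : (forall x, x \in `[a, b] -> f x = g x) ->
  ae_integral a b f I -> ae_integral a b g I.
Proof.
move=> fg [h [ih fh hI]]; exists h; split => //.
by apply: filterS fh => x + Dx => <-//; rewrite fg.
Qed.

Lemma integrable_ae_integral a b f : leb.-integrable `[a, b] (EFin \o f) ->
  ae_integral a b f (\int[leb]_(x in `[a, b]) f x).
Proof. by move=> fi; exists f; split => //; exact: ae_eq_refl. Qed.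

Lemma ae_integralD a b f g I J : ae_integral a b f I -> ae_integral a b g J ->
  ae_integral a b (fun x => f x + g x) (I + J).
Proof.
move=> [f' [if' ff' <-]] [g' [ig' gg' <-]]; exists (fun x => f' x + g' x); split.
- have := @integrableD _ _ _ leb `[a, b]%classic _ _ _ if' ig'.
  by apply.
- by apply: filterS2 ff' gg' => x + + Dx => /(_ Dx) -> /(_ Dx) ->.
- by rewrite RintegralD.
Qed.

Lemma ae_integralZ a b f I k : ae_integral a b f I ->
  ae_integral a b (fun x => k * f x) (k * I).
Proof.
move=> [f' [if' ff' <-]]; exists (fun x => k * f' x); split.
- have := @integrableZl _ _ _ leb `[a, b]%classic _ k _ if'.
  by apply.
- by apply: filterS ff' => x + Dx => /(_ Dx) ->.
- by rewrite RintegralZl.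
Qed.

Lemma ae_integralN a b f I : ae_integral a b f I ->
  ae_integral a b (fun x => - f x) (- I).
Proof.
move=> /(ae_integralZ (-1)); rewrite mulN1r.
by apply: eq_ae_integral => x _; rewrite mulN1r.
Qed.

Lemma ae_integralB a b f g I J : ae_integral a b f I -> ae_integral a b g J ->
  ae_integral a b (fun x => f x - g x) (I - J).
Proof. by move=> fI /ae_integralN; exact: ae_integralD. Qed.

Lemma ae_integral0 a b : ae_integral a b (fun=> 0) 0.
Proof.
exists (cst 0); split; first exact: (integrable0 _).
- exact: ae_eq_refl.
- by rewrite Rintegral_cst ?mul0r.
Qed.

Lemma ae_integral_sum a b (K : eqType) (s : seq K) (f : K -> R -> R) (I : K -> R) :
  (forall i, i \in s -> ae_integral a b (f i) (I i)) ->
  ae_integral a b (fun x => \sum_(i <- s) f i x) (\sum_(i <- s) I i).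
Proof.
elim: s => [_|i s IH fI].
  rewrite big_nil; apply: eq_ae_integral (ae_integral0 a b) => x _.
  by rewrite big_nil.
have fi : ae_integral a b (f i) (I i) by apply: fI; exact: mem_head.
have {}IH : ae_integral a b (fun x => \sum_(i <- s) f i x) (\sum_(i <- s) I i).
  by apply: IH => k ks; apply: fI; rewrite inE ks orbT.
rewrite big_cons; apply: eq_ae_integral (ae_integralD fi IH) => x _.
by rewrite big_cons.
Qed.

Lemma ae_integral_ge0 a b f I : (forall x, x \in `[a, b] -> 0 <= f x) ->
  ae_integral a b f I -> 0 <= I.
Proof.
move=> f0 /ae_integralE <-; apply: Rintegral_ge0 => x xab; exact: f0.
Qed.

Lemma ae_integral_le a b f g I J : (forall x, x \in `[a, b] -> f x <= g x) ->
  ae_integral a b f I -> ae_integral a b g J -> I <= J.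
Proof.
move=> fg fI gJ; rewrite -subr_ge0.
apply: (ae_integral_ge0 _ (ae_integralB gJ fI)) => x xab.
by rewrite subr_ge0 fg.
Qed.

Lemma ae_integralS a b c f I : a <= c -> ae_integral a b f I ->
  exists J, ae_integral c b f J.
Proof.
move=> ac [h [ih fh _]].
have sub : `[c, b]%classic `<=` `[a, b]%classic.
  by move=> x /=; rewrite !in_itv/= => /andP[cx ->]; rewrite (le_trans ac).
exists (\int[leb]_(x in `[c, b]) h x), h; split => //.
- exact: integrableS ih.
- exact: ae_eq_subset fh.
Qed.

Lemma continuous_ae_integral a b f : {within `[a, b], continuous f} ->
  ae_integral a b f (\int[leb]_(x in `[a, b]) f x).
Proof.
move=> cf; apply: integrable_ae_integral.
by apply: continuous_compact_integrable => //; exact: segment_compact.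
Qed.

(** A continuous factor is bounded on the compact segment, so it preserves integrability; it will be
    an exponential kernel. *)
Lemma ae_integralMc a b f g I : {within `[a, b], continuous g} ->
  ae_integral a b f I -> exists J, ae_integral a b (fun x => g x * f x) J.
Proof.
move=> cg [h [ih fh _]].
have igh : leb.-integrable `[a, b] (EFin \o (fun x => g x * h x)).
  have := @integrableMr _ _ _ leb `[a, b]%classic _ g (EFin \o h) _ _ ih; apply => //.
    exact: subspace_continuous_measurable_fun.
  have [M [_ Mb]] := compact_bounded (continuous_compact cg (@segment_compact _ a b)).
  by exists M; split; rewrite ?num_real// => y My x xab; apply: (Mb y) => //; exists x.
exists (\int[leb]_(x in `[a, b]) (g x * h x)), (fun x => g x * h x); split => //.
by apply: filterS fh => x + Dx => /(_ Dx) ->.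
Qed.

End ae_integral.

(** * Bochner integrals tested against a fixed vector *)

Section bochner_dot.
Context {R : realType} {d : nat} {Omega : @smooth_domain R d}.
Local Notation E := (L2 Omega).
Local Notation leb := (@lebesgue_measure R).
Local Notation nrm := (fun v : E => (L2norm v)%:E).

Lemma cvg_dist_le {T : Type} {F : set_system T} {FF : Filter F}
    (u e : T -> R) (l : R) :
  (\forall x \near F, `|u x - l| <= e x) -> e @ F --> 0 -> u @ F --> l.
Proof.
move=> ue e0; apply/cvgrPdist_lt => eps eps0; near=> x.
rewrite distrC (@le_lt_trans _ _ (e x))//; first by near: x.
rewrite (le_lt_trans (ler_norm _))//.
by near: x; exact: cvgr0_norm_lt.
Unshelve. all: by end_near. Qed.

(** The complement of [a, b] is null for the restricted measure, so [f] may be cut off there,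
    whether or not it is measurable. *)
Lemma integral_itv_measure (a b : R) (f : R -> \bar R) :
  (\int[itv_measure a b]_t f t = \int[leb]_(t in `[a, b]) f t)%E.
Proof.
transitivity (\int[itv_measure a b]_(t in `[a, b]) f t)%E.
  rewrite [RHS]integral_mkcond; apply: ae_eq_lower_integral.
  exists (~` `[a, b]%classic); split.
  - exact: measurableC.
  - rewrite [LHS]/(lebesgue_measure (~` `[a, b]%classic `&` `[a, b]%classic)).
    by rewrite setICl measure0.
  - move=> t /= ht tab; apply: ht => _; rewrite patchE mem_set//.
apply: eq_measure_integral => A mA Aab.
by rewrite [LHS]/(lebesgue_measure (A `&` `[a, b]%classic)) setIidl.
Qed.

Lemma ae_itv_measure (a b : R) (P : R -> Prop) :
  {ae itv_measure a b, forall t, P t} ->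
  {ae leb, forall t, `[a, b]%classic t -> P t}.
Proof.
move=> [N [mN N0 PN]]; exists (N `&` `[a, b]%classic); split => //.
  exact: measurableI.
by move=> t /= /not_implyP[tab nP]; split => //; exact: PN.
Qed.

Lemma integral_dot_simple_fun (a b : R) (s : simple nrm) (w : E) :
  leb.-integrable `[a, b] (EFin \o (fun t => dot (simple_fun s t) w)) /\
  \int[leb]_(t in `[a, b]) dot (simple_fun s t) w =
    dot (simple_integral a b s) w.
Proof.
have indI i : leb.-integrable `[a, b] (EFin \o \1_(simple_set (s := s) i)).
  apply: measurable_bounded_integrable => //.
  - by rewrite /= lebesgue_measure_itv/=; case: ifP => // _; rewrite -EFinB ltry.
  - by apply: measurable_indic; exact: simple_measurable.
  - exists 1; split; rewrite ?num_real// => y y1 x _ /=.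
    by rewrite indicE ger0_norm// (le_trans _ (ltW y1))// lern1 leq_b1.
have dotE t : dot (simple_fun s t) w =
    \sum_i dot (simple_val (s := s) i) w * \1_(simple_set (s := s) i) t.
  by rewrite dot_suml; apply: eq_bigr => i _; rewrite dotZl mulrC.
have dotI : leb.-integrable `[a, b] (EFin \o (fun t => dot (simple_fun s t) w)).
  apply: (@eq_integrable _ _ _ leb `[a, b]%classic _ (fun t => \sum_i
      (dot (simple_val (s := s) i) w)%:E * (\1_(simple_set (s := s) i) t)%:E)%E) => //.
    by move=> t _; rewrite /= dotE sumEFin.
  apply: (@integrable_sum _ _ _ leb `[a, b]%classic) => // i _.
  have := @integrableZl _ _ _ leb `[a, b]%classic _
    (dot (simple_val (s := s) i) w) _ (indI i).
  by apply.
split => //; apply: ae_integral_unique; first exact: integrable_ae_integral.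
have := @ae_integral_sum _ a b _ (index_enum _) _ _ (fun i _ =>
  ae_integralZ (dot (simple_val (s := s) i) w) (integrable_ae_integral (indI i))).
rewrite dot_suml; under [X in _ -> ae_integral _ _ _ X]eq_bigr do rewrite dotZl.
under [X in ae_integral _ _ _ X -> _]eq_bigr => i _.
  rewrite /Rintegral integral_indic//=; last exact: simple_measurable.
  rewrite mulrC. over.
by apply: eq_ae_integral => t _; rewrite dotE.
Qed.

(** Off a null set [N], <f t, w> is the limit of the products <s_k t, w> of the approximating simple
    functions, hence agrees with a Borel function [h]. By Cauchy-Schwarz [h - phi k] is bounded by
    |w| |f - s_k|, which tends to 0 in mean. So the integrals of [phi k] tend both to that of [h]
    and to <v, w>. *)
Lemma is_bochner_integral_dot (a b : R) (f : R -> E) (v w : E) :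
  is_bochner_integral nrm a b f v -> ae_integral a b (fun t => dot (f t) w) (dot v w).
Proof.
move=> [s [/ae_itv_measure[N [mN N0 cvN]] sf sv]].
pose X k := (\int[leb]_(t in `[a, b]) nrm (f t - simple_fun (s k) t)%R)%E.
(* [X k] may be infinite for small [k]; convergence to 0 makes it finite eventually. *)
have {sf} [Xfin X0] : (\forall k \near \oo, X k \is a fin_num) /\
    (fine \o X) @ \oo --> (0 : R).
  apply/fine_cvgP; rewrite (_ : X = fun k =>
    (\int[itv_measure a b]_t nrm (f t - simple_fun (s k) t)%R)%E)//.
  by apply/funext => k; rewrite integral_itv_measure.
pose phi k t := dot (simple_fun (s k) t) w.
have iphi k : leb.-integrable `[a, b] (EFin \o phi k).
  by have [] := integral_dot_simple_fun a b (s k) w.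
pose h := (fun t => dot (f t) w) \_ (~` N).
have mCN : measurable (~` N) by exact: measurableC.
have mh : measurable_fun `[a, b] h.
  apply: (@measurable_fun_cvg _ _ _ `[a, b]%classic (fun k => phi k \_ (~` N))).
    move=> k; apply/measurable_restrict => //.
    have /measurable_EFinP mphi := measurable_int leb (iphi k).
    by apply: measurable_funS mphi => //; exact: subIsetl.
  move=> t tab; rewrite /h patchE; case: ifPn => tN; last first.
    rewrite (_ : (fun _ => _) = fun=> 0); first exact: cvg_cst.
    by apply/funext => k; rewrite patchE (negbTE tN).
  rewrite (_ : (fun _ => _) = phi^~ t); last first.
    by apply/funext => k; rewrite patchE tN.
  have /fine_cvgP[_ ft0] :
      nrm (f t - simple_fun (s k) t)%R @[k --> \oo] --> (0 : R)%:E.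
    apply: contrapT => nft; move/set_mem: tN; apply; apply: cvN => /=.
    by move=> /(_ tab).
  apply: (@cvg_dist_le _ _ _ _ (fun k => L2norm w * L2norm (f t - simple_fun (s k) t))).
    by apply: nearW => k; rewrite distrC -dotBl mulrC dot_norm_le.
  by rewrite -[X in _ --> X](mulr0 (L2norm w)); apply: cvgMr.
(* The summand 1 makes [c] invertible: the constant is moved to the side of the measurable function
   [h - phi k], because the norm integrated in [X k] need not be measurable. *)
pose c := L2norm w + 1.
have c0 : 0 < c by rewrite ltr_wpDl// L2norm_ge0.
have mhphi k : measurable_fun `[a, b] (fun t => `|h t - phi k t|).
  have /measurable_EFinP mphi := measurable_int leb (iphi k).
  by apply: measurableT_comp => //; exact: measurable_funB.
have hX k : (\int[leb]_(t in `[a, b]) `|h t - phi k t|%:E <= c%:E * X k)%E.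
  rewrite muleC -lee_pdivrMr// muleC.
  rewrite -ge0_integralZl_EFin ?invr_ge0 ?(ltW c0)//; last first.
    by apply/measurable_EFinP; exact: mhphi.
  apply: ge0_ae_le_lower_integral.
  - by move=> t _; rewrite -EFinM lee_fin mulr_ge0// invr_ge0 ltW.
  - by move=> t _; rewrite lee_fin L2norm_ge0.
  exists N; split => // t /=; apply: contra_notP => tN _.
  rewrite -EFinM lee_fin mulrC ler_pdivrMr// /h patchE mem_set//= -dotBl.
  rewrite (le_trans (dot_norm_le _ _))// ler_wpM2l ?L2norm_ge0//.
  by rewrite lerDl.
(* For one [k] with [X k] finite, [h] is the sum of the integrable functions [h - phi k] and
   [phi k]. *)
have ih : leb.-integrable `[a, b] (EFin \o h).
  have [k Xk] : exists k, X k \is a fin_num.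
    by case: Xfin => k _ /(_ k (leqnn k)); exists k.
  have ihphi : leb.-integrable `[a, b] (EFin \o (fun t => h t - phi k t)).
    apply/integrableP; split.
      have /measurable_EFinP mphi := measurable_int leb (iphi k).
      by apply/measurable_EFinP; exact: measurable_funB.
    rewrite (le_lt_trans (hX k))// lte_mul_pinfty// ?lee_fin ?(ltW c0)//.
    by rewrite -(fineK Xk) ltry.
  have := @integrableD _ _ _ leb `[a, b]%classic _ _ _ ihphi (iphi k).
  move=> /(_ (measurable_itv _)); apply: eq_integrable => //.
  by move=> t _; rewrite /= -EFinD subrK.
exists h; split => //.
  exists N; split => // t /=; apply: contra_notP => tN _.
  by rewrite /h patchE mem_set.
have lim1 : \int[leb]_(t in `[a, b]) phi k t @[k --> \oo] -->
    \int[leb]_(t in `[a, b]) h t.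
  apply: (@cvg_dist_le _ _ _ _ (fun k => c * fine (X k))); last first.
    by rewrite -[X in _ --> X](mulr0 c); exact: cvgMr.
  apply: filterS Xfin => k Xk; rewrite distrC -RintegralB//.
  have ihphi : leb.-integrable `[a, b] (EFin \o (fun t => h t - phi k t)).
    have := @integrableB _ _ _ leb `[a, b]%classic _ _ _ ih (iphi k).
    by apply.
  rewrite (le_trans (le_normr_Rintegral _ ihphi))//.
  have cXk : (c%:E * X k)%E \is a fin_num by rewrite fin_numM.
  rewrite (_ : c * _ = fine (c%:E * X k)%E); last by rewrite fineM.
  by rewrite fine_le// integrable_fin_num//; exact: integrable_norm.
have lim2 : \int[leb]_(t in `[a, b]) phi k t @[k --> \oo] --> dot v w.
  have /fine_cvgP[_ sv0] := sv.
  apply: (@cvg_dist_le _ _ _ _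
    (fun k => L2norm w * L2norm (simple_integral a b (s k) - v))).
    apply: nearW => k; have [_ ->] := integral_dot_simple_fun a b (s k) w.
    by rewrite -dotBl mulrC dot_norm_le.
  by rewrite -[X in _ --> X](mulr0 (L2norm w)); apply: cvgMr.
exact: (cvg_unique _ lim1 lim2).
Qed.

Lemma L2integral_dot (a b : R) (f : R -> E) (w : E) : L2integrable a b f ->
  ae_integral a b (fun t => dot (f t) w) (dot (L2integral a b f) w).
Proof.
move=> [v fv]; apply: is_bochner_integral_dot.
exact: (@xgetI _ _ [set v | is_bochner_integral nrm a b f v] v).
Qed.

End bochner_dot.

(** * One-variable calculus on a segment *)

Section calculus.
Context {R : realType}.
Local Notation leb := (@lebesgue_measure R).

(** A point with [c < f t] would, by continuity, give a nonempty open interval of such points inside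
    the null exceptional set. *)
Lemma ae_le_continuous (a b c : R) (f : R -> R) : a < b ->
  {within `[a, b], continuous f} ->
  {ae leb, forall t, `[a, b]%classic t -> f t <= c} ->
  forall t, t \in `[a, b] -> f t <= c.
Proof.
move=> ab /subspace_continuousP cf [N [mN N0 fN]] t tab.
rewrite leNgt; apply/negP => cft.
have /nbhs_ballP[e /= e0 et] : within `[a, b] (nbhs t) [set s | c < f s].
  by move: (cf t tab) => /cvgr_gt; apply.
move: tab; rewrite in_itv/= => /andP[ta tb].
(* Clipping the [e]-ball around [t] to [a, b] leaves an interval of positive length even when [t] is
   an endpoint, thanks to [a < b]. *)
pose l := Num.max a (t - e); pose r := Num.min b (t + e).
have lr : l < r.
  by rewrite /l /r lt_min !gt_max; apply/andP; split; apply/andP; split; lra.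
suff : (leb `]l, r[ <= leb N)%E.
  by rewrite N0 lebesgue_measure_itv/= lte_fin lr -EFinD lee_fin subr_le0 leNgt lr.
apply: le_measure; rewrite ?inE// => s /=; rewrite in_itv/= /l /r.
rewrite lt_min gt_max => /andP[/andP[as_ ts] /andP[sb st]].
have sab : `[a, b]%classic s by rewrite /= in_itv/= !ltW.
apply: fN => /= /(_ sab); rewrite leNgt => /negP; apply.
apply: et => //; rewrite /ball/= ltr_distl; apply/andP; split; lra.
Qed.

(** The primitive is [- expR (L * (b - s))]. This closed form is what makes a single comparison
    replace the iteration of Gronwall's inequality. *)
Lemma ae_integral_expR (L t b : R) : t <= b ->
  ae_integral t b (fun s => L * expR (L * (b - s))) (expR (L * (b - t)) - 1).
Proof.
have cexp : continuous (fun s : R => L * expR (L * (b - s))).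
  move=> s; apply: cvgMr.
  apply: (@continuous_comp _ _ _ (fun s : R => L * (b - s)) expR);
    last exact: continuous_expR.
  by apply: cvgMr; apply: cvgB; [exact: cvg_cst|exact: cvg_id].
(* The fundamental theorem of calculus is applied for [t < b]; for [t = b] both sides vanish. *)
rewrite le_eqVlt => /predU1P[->|tb].
  rewrite subrr mulr0 expR0 subrr.
  have := @continuous_ae_integral _ b b _ (continuous_subspaceT cexp).
  by rewrite set_itv1 Rintegral_set1.
have dexp (s : R) :
    is_derive s 1 (fun s : R => - expR (L * (b - s))) (L * expR (L * (b - s))).
  apply: is_derive_eq.
  by rewrite /GRing.scale/=; ring.
have := @continuous_ae_integral _ t b _ (continuous_subspaceT cexp).
rewrite /Rintegral.
rewrite (@continuous_FTC2 _ _ (fun s => - expR (L * (b - s))))//.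
- by rewrite subrr mulr0 expR0 -EFinB /= opprK addrC.
- exact: continuous_subspaceT.
- have cf : continuous (fun s : R => - expR (L * (b - s))).
    by move=> s; apply: differentiable_continuous; apply/derivable1_diffP.
  split => //.
  + by apply: cvg_at_right_filter; exact: cf.
  + by apply: cvg_at_left_filter; exact: cf.
- by move=> s _; rewrite derive1E derive_val.
Qed.

(** The tail is the full integral minus the integral over [a, s], which is continuous in its upper
    limit. *)
Lemma continuous_tail_integral (a b : R) (f : R -> R) :
  {within `[a, b], continuous f} ->
  {within `[a, b], continuous (fun s => \int[leb]_(x in `[s, b]) f x)}.
Proof.
move=> cf.
have [ab|ba] := leP a b; last first.
  by rewrite set_itv_ge -?leNgt ?bnd_simp//; exact: continuous_subspace0.
have fi : leb.-integrable `[a, b] (EFin \o f).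
  by apply: continuous_compact_integrable => //; exact: segment_compact.
have cP := parameterized_integral_continuous ab fi.
apply: (@subspace_eq_continuous _ _ _ (fun s =>
    \int[leb]_(x in `[a, b]) f x - \int[leb]_(x in `[a, s]) f x)).
  move=> s; rewrite inE/= => /[dup] sab; rewrite in_itv/= => /andP[as_ sb].
  rewrite Rintegral_itvB ?bnd_simp// Rintegral_itv_obnd_cbnd//.
  by apply: integrableS fi => //; apply: subset_itvr; rewrite bnd_simp.
by move=> s; apply: cvgB; [exact: cvg_cst|exact: cP].
Qed.

End calculus.

(** * Continuity of coefficients and norms along L^2-continuous curves *)

Section L2_continuity.
Context {R : realType} {d : nat} {Omega : @smooth_domain R d} (tau : R).
Local Notation E := (L2 Omega).
Implicit Types (u v : R -> E).

Lemma continuous_L2_dot u (w : E) : continuous_L2 tau u ->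
  {within `[0, tau], continuous (fun t => dot (u t) w)}.
Proof.
move=> cu; apply/subspace_continuousP => t tab.
apply: (@cvg_dist_le _ _ _ _ _ (fun s => L2norm w * L2norm (u s - u t))).
  by apply: nearW => s; rewrite -dotBl mulrC dot_norm_le.
by rewrite -[X in _ --> X](mulr0 (L2norm w)); apply: cvgMr; exact: cu.
Qed.

Lemma continuous_L2_norm u : continuous_L2 tau u ->
  {within `[0, tau], continuous (fun t => L2norm (u t))}.
Proof.
move=> cu; apply/subspace_continuousP => t tab.
apply: (@cvg_dist_le _ _ _ _ _ (fun s => L2norm (u s - u t))); last exact: cu.
by apply: nearW => s; exact: L2norm_dist_le.
Qed.

Lemma continuous_L2B u v : continuous_L2 tau u -> continuous_L2 tau v ->
  continuous_L2 tau (fun t => u t - v t).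
Proof.
move=> cu cv t tab.
apply: (@cvg_dist_le _ _ _ _ _ (fun s => L2norm (u s - u t) + L2norm (v s - v t))).
  apply: nearW => s; rewrite subr0 ger0_norm ?L2norm_ge0//.
  rewrite -(L2normN (v s - v t)) (_ : _ - _ = (u s - u t) + - (v s - v t)).
    exact: L2norm_triangle.
  by rewrite !opprB [v t - u t]addrC addrACA [- v s + v t]addrC.
by rewrite -[X in _ --> X](addr0 0); apply: cvgD; [exact: cu|exact: cv].
Qed.

End L2_continuity.

(** * Expansions in the eigenbasis and the Gevrey tail bound *)

Section spectral.
Context {R : realType} {d : nat} {Omega : @smooth_domain R d}.
Local Notation E := (L2 Omega).
Context (lam : nat -> R) (phi : nat -> E) (eig : dirichlet_eigensystem lam phi).

Lemma lam_gt0 j : (1 <= j)%N -> 0 < lam j.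
Proof.
move=> j1; apply: lt_le_trans (eigen_gt0 eig) _.
by apply: (eigen_nondecreasing eig); rewrite j1.
Qed.

Lemma dot_phi_sum (a : nat -> R) N k : (1 <= k)%N ->
  dot (\sum_(1 <= j < N.+1) a j *: phi j) (phi k) = if (k <= N)%N then a k else 0.
Proof.
move=> k1; rewrite dot_suml.
transitivity (\sum_(1 <= j < N.+1 | j == k) a j).
  rewrite [RHS]big_mkcond; apply: eq_big_nat => j /andP[j1 _].
  by rewrite dotZl (eigen_orthonormal eig)//; case: eqP; rewrite ?mulr1 ?mulr0.
by rewrite big_nat1_eq k1.
Qed.

Lemma sqr_L2norm_sum (a : nat -> R) N :
  L2norm (\sum_(1 <= j < N.+1) a j *: phi j) ^+ 2 = \sum_(1 <= j < N.+1) a j ^+ 2.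
Proof.
rewrite sqr_L2norm {2}big_nat_cond dot_sumr -big_nat_cond.
apply: eq_big_nat => j /andP[j1 jN].
by rewrite dotZr dot_phi_sum// -ltnS jN expr2.
Qed.

(** By orthonormality the defect in Bessel's inequality is the squared distance from [f] to its
    partial sum, which tends to 0 since the eigenfunctions form a basis. *)
Lemma parseval (f : E) :
  \sum_(1 <= j < n.+1) dot f (phi j) ^+ 2 @[n --> \oo] --> L2norm f ^+ 2.
Proof.
have Bn n : L2norm f ^+ 2 - \sum_(1 <= j < n.+1) dot f (phi j) ^+ 2 =
    L2norm (f - \sum_(1 <= j < n.+1) dot f (phi j) *: phi j) ^+ 2.
  set P := (X in f - X).
  have PP : dot P P = \sum_(1 <= j < n.+1) dot f (phi j) ^+ 2.
    by rewrite -sqr_L2norm sqr_L2norm_sum.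
  have fP : dot f P = \sum_(1 <= j < n.+1) dot f (phi j) ^+ 2.
    by rewrite dot_sumr; apply: eq_bigr => j _; rewrite dotZr expr2.
  by rewrite !sqr_L2norm dotBl !dotBr (dotC P) fP PP subrr subr0.
apply: (@cvg_dist_le _ _ _ _ _ (fun n =>
    L2norm (f - \sum_(1 <= j < n.+1) dot f (phi j) *: phi j) ^+ 2)).
  by apply: nearW => n; rewrite distrC Bn ger0_norm// sqr_ge0.
have := eigen_basis eig f => /(fun h => cvgM h h); rewrite mul0r.
by apply: cvg_trans; apply: near_eq_cvg; apply: nearW => n; rewrite /= expr2.
Qed.

(** For [a] and [b] nonnegative the weight [wt j] is nondecreasing in [j], so [wt N] times the tail
    is at most the full weighted series, hence at most [M ^+ 2]. *)
Lemma gevrey_tail (a b M : R) (N n : nat) (psi : E) : 0 <= a -> 0 <= b ->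
  (1 <= N)%N -> 0 <= M -> (gevrey_norm lam phi a b psi <= M%:E)%E ->
  \sum_(N.+1 <= j < n.+1) dot psi (phi j) ^+ 2 <=
    (M * lam N `^ (- a) * expR (- (b * lam N))) ^+ 2.
Proof.
move=> a0 b0 N1 M0 gM.
have [nN|Nn] := leqP n N; first by rewrite big_geq// sqr_ge0.
pose wt j := lam j `^ (2 * a) * expR (2 * b * lam j).
pose S := (\sum_(1 <= j <oo) (wt j * `|dot psi (phi j)| ^+ 2)%:E)%E.
have t0 j : (0 <= (wt j * `|dot psi (phi j)| ^+ 2)%:E)%E.
  by rewrite lee_fin mulr_ge0// ?mulr_ge0 ?powR_ge0 ?expR_ge0 ?sqr_ge0.
have S0 : (0 <= S)%E by apply: nneseries_ge0.
have SM : (S <= (M ^+ 2)%:E)%E.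
  have : ((S `^ 2^-1) `^ 2 <= M%:E `^ 2)%E.
    by rewrite gt0_ler_poweR// in_itv/= ?leey ?andbT ?poweR_ge0 ?lee_fin.
  by rewrite -poweRrM mulVf// poweRe1// poweR_EFin powR_mulrn.
have wN0 : 0 < wt N by rewrite mulr_gt0 ?powR_gt0 ?expR_gt0 ?lam_gt0.
have wNE : (M * lam N `^ (- a) * expR (- (b * lam N))) ^+ 2 = M ^+ 2 / wt N.
  rewrite !exprMn -mulrA; congr (_ * _).
  rewrite /wt invfM powRN -expRN; congr (_ * _).
    by rewrite exprVn -powR_mulrn ?powR_ge0// -powRrM mulrC.
  by rewrite -expRM_natl; congr expR; ring.
rewrite wNE ler_pdivlMr// mulr_suml.
apply: (@le_trans _ _ (\sum_(N.+1 <= j < n.+1) wt j * `|dot psi (phi j)| ^+ 2)).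
  rewrite big_nat_cond [leRHS]big_nat_cond; apply: ler_sum => j.
  rewrite andbT => /andP[Nj jn]; rewrite mulrC real_normK ?num_real//.
  rewrite ler_wpM2r ?sqr_ge0//.
  have lNj : lam N <= lam j by apply: (eigen_nondecreasing eig); rewrite N1 ltnW.
  have lN0 := lam_gt0 N1.
  rewrite ler_pM ?powR_ge0 ?expR_ge0//.
    by rewrite ge0_ler_powR ?nnegrE ?mulr_ge0// ltW// (lt_le_trans lN0).
  by rewrite ler_expR ler_wpM2l// mulr_ge0.
have /le_trans/(_ SM) : (\sum_(1 <= j < n.+1) (wt j * `|dot psi (phi j)| ^+ 2)%:E <= S)%E.
  exact: nneseries_lim_ge.
rewrite sumEFin lee_fin; apply: le_trans.
rewrite (@big_cat_nat _ _ _ N.+1 1)//= ?(ltnW Nn)//; last by rewrite ltnS ltnW.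
by rewrite lerDr sumr_ge0// => j _; rewrite -lee_fin.
Qed.

End spectral.

(** * Mode equations for the error, and the weighted estimate *)

Section truncation_error.
Context {R : realType} {d : nat} {Omega : @smooth_domain R d}.
Local Notation E := (L2 Omega).
Local Notation leb := (@lebesgue_measure R).
Context (tau : R) (tau_gt0 : 0 < tau) (lam : nat -> R) (phi : nat -> E)
  (eig : dirichlet_eigensystem lam phi)
  (F : R -> E -> E) (kappa : R) (kappa_gt0 : 0 < kappa)
  (F_lip : lipschitz_source tau kappa F) (g : E) (u : R -> E)
  (u_sol : fvp_solution tau F g u) (u_coef : coefficient_formula tau lam phi F g u)
  (N : nat) (N_ge1 : (1 <= N)%N) (uN : R -> E)
  (uN_sol : truncated_solution tau lam phi F g N uN).

Let cu : continuous_L2 tau u. Proof. by case: u_sol. Qed.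
Let cuN : continuous_L2 tau uN. Proof. by case: uN_sol. Qed.
Local Notation err t := (u t - uN t).
Let cerr : continuous_L2 tau (fun t => err t). Proof. exact: continuous_L2B. Qed.

Let sub_itv (s t : R) : 0 <= s -> t \in `[s, tau] -> t \in `[0, tau].
Proof. by move=> s0; rewrite !in_itv/= => /andP[/(le_trans s0) -> ->]. Qed.

Let subset_itv_tau (s : R) : 0 <= s -> `[s, tau]%classic `<=` `[0, tau]%classic.
Proof. by move=> s0 t /=; rewrite !in_itv/= => /andP[/(le_trans s0) -> ->]. Qed.

Let ae_integral_dot (v : R -> E) (w : E) (s : R) : continuous_L2 tau v -> 0 <= s ->
  ae_integral s tau (fun x => dot (v x) w) (\int[leb]_(x in `[s, tau]) dot (v x) w).
Proof.
move=> cv s0; apply: continuous_ae_integral.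
exact: (continuous_subspaceW (subset_itv_tau s0) (continuous_L2_dot cv)).
Qed.

Let continuous_kernel (k t : R) : continuous (fun s : R => expR (k * (s - t))).
Proof.
move=> s; apply: (@continuous_comp _ _ _ (fun s : R => k * (s - t)) expR);
  last exact: continuous_expR.
by apply: cvgMr; apply: cvgB; [exact: cvg_id|exact: cvg_cst].
Qed.

(** Tested against [phi j], the truncated semigroup becomes multiplication by an exponential and
    Bochner integrals become scalar ones. The witnesses [I] and [J] record integrability together
    with the values. *)
Lemma truncated_solution_dot_low j t : (1 <= j <= N)%N -> t \in `[0, tau] ->
  exists I J,
  [/\ ae_integral t tau
        (fun s => expR (lam j * (s - t)) * dot (F s (uN s)) (phi j)) I,
      ae_integral t tau (fun s => expR (lam j * (s - t)) *
        \int[leb]_(x in `[s, tau]) dot (uN x) (phi j)) J &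
      dot (uN t) (phi j) = expR (lam j * (tau - t)) * dot g (phi j) - I - J].
Proof.
move=> /andP[j1 jN] tI; have [_ /(_ t tI)[i1 _ i2 eq0]] := uN_sol.
set I1 := L2integral _ _ _ in eq0; set I2 := L2integral _ _ _ in eq0.
exists (dot I1 (phi j)), (dot I2 (phi j)).
have Sdot r psi : dot (truncated_semigroup lam phi N r psi) (phi j) =
    expR (lam j * r) * dot psi (phi j).
  by rewrite /truncated_semigroup (dot_phi_sum eig)// jN.
split.
- apply: eq_ae_integral (L2integral_dot (phi j) i1) => s _; exact: Sdot.
- apply: eq_ae_integral (L2integral_dot (phi j) i2) => s sI.
  rewrite Sdot; congr (_ * _).
  (* The inner integral starts at [s], so its existence is read off the truncated equation at time
     [s]. *)
  have sI0 : s \in `[0, tau].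
    by apply: sub_itv sI; move: tI; rewrite in_itv => /andP[].
  have [_ /(_ s sI0)[_ i3 _ _]] := uN_sol.
  by rewrite (ae_integralE (L2integral_dot (phi j) i3)).
- move: (L2norm_eq0_dot (phi j) eq0).
  by rewrite dotBl !dotBl Sdot => /eqP; rewrite subr_eq0 => /eqP.
Qed.

(** Every term on the right of the truncated equation takes values in the span of the first [N]
    eigenfunctions, up to null functions, and is orthogonal to [phi j]. *)
Lemma truncated_solution_dot_high j t : (N < j)%N -> t \in `[0, tau] ->
  dot (uN t) (phi j) = 0.
Proof.
move=> Nj tI; have [_ /(_ t tI)[i1 _ i2 eq0]] := uN_sol.
have Sdot r psi : dot (truncated_semigroup lam phi N r psi) (phi j) = 0.
  by rewrite /truncated_semigroup (dot_phi_sum eig) ?(leq_ltn_trans _ Nj)// leqNgt Nj.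
have Idot (v : R -> E) : L2integrable t tau v ->
    (forall s, dot (v s) (phi j) = 0) -> dot (L2integral t tau v) (phi j) = 0.
  move=> /(L2integral_dot (phi j)) iv v0.
  apply: ae_integral_unique iv _; apply: eq_ae_integral (ae_integral0 _ _) => s _.
  by rewrite v0.
move: (L2norm_eq0_dot (phi j) eq0).
have I10 := Idot _ i1 (fun=> Sdot _ _); have I20 := Idot _ i2 (fun=> Sdot _ _).
set I1 := L2integral _ _ _ in I10 *; set I2 := L2integral _ _ _ in I20 *.
clearbody I1 I2; by rewrite dotBl !dotBl I10 I20 Sdot !subr0.
Qed.

(** The coefficient formula gives the values; this adds integrability. The source term inherits it
    from the Bochner integrability of F(s, u(s)), and the memory term is continuous. *)
Lemma solution_dot j t : (1 <= j)%N -> t \in `[0, tau] ->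
  exists I J,
  [/\ ae_integral t tau
        (fun s => expR (lam j * (s - t)) * dot (F s (u s)) (phi j)) I,
      ae_integral t tau (fun s => expR (lam j * (s - t)) *
        \int[leb]_(x in `[s, tau]) dot (u x) (phi j)) J &
      dot (u t) (phi j) = expR (lam j * (tau - t)) * dot g (phi j) - I - J].
Proof.
move=> j1 tI; have t0 : 0 <= t by move: tI; rewrite in_itv => /andP[].
have [_ iF _ _] := u_sol.
have ck : {within `[t, tau], continuous (fun s : R => expR (lam j * (s - t)))}.
  exact: continuous_subspaceT.
have [I0 FI0] := ae_integralS t0 (L2integral_dot (phi j) iF).
have [I FI] := ae_integralMc ck FI0.
exists I, (\int[leb]_(s in `[t, tau]) (expR (lam j * (s - t)) *
   \int[leb]_(x in `[s, tau]) dot (u x) (phi j))); split => //.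
  apply: continuous_ae_integral => s; apply: cvgM; first exact: ck.
  apply: (@continuous_tail_integral _ t tau (fun x => dot (u x) (phi j))).
  exact: (continuous_subspaceW (subset_itv_tau t0) (continuous_L2_dot cu)).
by rewrite u_coef// (ae_integralE FI).
Qed.

(** Both solutions have the same final value [g], so its contributions cancel in the difference. *)
Lemma error_dot_low j t : (1 <= j <= N)%N -> t \in `[0, tau] ->
  ae_integral t tau (fun s => expR (lam j * (s - t)) *
      (dot (F s (u s) - F s (uN s)) (phi j) +
       \int[leb]_(x in `[s, tau]) dot (err x) (phi j)))
    (- dot (err t) (phi j)).
Proof.
move=> jN tI; have j1 : (1 <= j)%N by case/andP: jN.
have t0 : 0 <= t by move: tI; rewrite in_itv => /andP[].
have [I [J [FI GJ uE]]] := solution_dot j1 tI.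
have [I' [J' [FI' GJ' uNE]]] := truncated_solution_dot_low jN tI.
rewrite (_ : - _ = (I - I') + (J - J')); last first.
  by rewrite dotBl uE uNE; ring.
apply: eq_ae_integral (ae_integralD (ae_integralB FI FI') (ae_integralB GJ GJ')) => s sI.
have s0 : 0 <= s by move: sI; rewrite in_itv/= => /andP[/(le_trans t0)].
have -> : \int[leb]_(x in `[s, tau]) dot (err x) (phi j) =
    \int[leb]_(x in `[s, tau]) dot (u x) (phi j) -
    \int[leb]_(x in `[s, tau]) dot (uN x) (phi j).
  apply: ae_integralE; apply: eq_ae_integral
    (ae_integralB (ae_integral_dot (phi j) cu s0) (ae_integral_dot (phi j) cuN s0)).
  by move=> x _; rewrite dotBl.
by rewrite dotBl; ring.
Qed.

(* With [V s = \sum_j <u(t) - uN(t), phi_j> e^(lam_j (s - t)) phi_j] over the low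
   modes, the squared norm of the low-mode part [P] of the error is the integral
   over [t, tau] of [- <F(s, u) - F(s, uN), V s> - \int_s^tau <u - uN, V s>],
   while [|V s| <= e^(lam_N (s - t)) |P|]. *)
Lemma low_error_le (m L t : R) : 0 <= m -> 1 <= L -> kappa + 1 <= L ->
  (forall s, s \in `[0, tau] ->
     L2norm (err s) <= m * expR (L * (tau - s)) * expR (- (lam N * s))) ->
  t \in `[0, tau] ->
  L2norm (\sum_(1 <= j < N.+1) dot (err t) (phi j) *: phi j) <=
    m * (expR (L * (tau - t)) - 1) * expR (- (lam N * t)).
Proof.
move=> m0 L1 kL em tI.
set P := \sum_(_ <= _ < _) _; set X := m * _ * _.
move: (tI); rewrite in_itv/= => /andP[t0 ttau].
have L0 : 0 < L by rewrite (lt_le_trans ltr01).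
pose V s := \sum_(1 <= j < N.+1) (dot (err t) (phi j) * expR (lam j * (s - t))) *: phi j.
have VP s : s \in `[t, tau] -> L2norm (V s) <= expR (lam N * (s - t)) * L2norm P.
  rewrite in_itv/= => /andP[ts _].
  rewrite -(@ler_pXn2r _ 2)// ?nnegrE ?mulr_ge0 ?expR_ge0 ?L2norm_ge0//.
  rewrite exprMn !(sqr_L2norm_sum eig) mulr_sumr.
  rewrite big_nat_cond [leRHS]big_nat_cond; apply: ler_sum => j.
  rewrite andbT ltnS => /andP[j1 jN].
  rewrite exprMn mulrC ler_wpM2r ?sqr_ge0// ler_pXn2r ?nnegrE ?expR_ge0//.
  rewrite ler_expR ler_wpM2r ?subr_ge0//.
  by apply: (eigen_nondecreasing eig); rewrite j1.
(* For [s <= x] the factor e^(-lam_N x) is at most e^(-lam_N s) and leaves the integral; the rest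
   integrates to (e^(L (tau - s)) - 1) / L. *)
have tailI s : s \in `[t, tau] ->
    - \sum_(1 <= j < N.+1) dot (err t) (phi j) * expR (lam j * (s - t)) *
        \int[leb]_(x in `[s, tau]) dot (err x) (phi j)
    <= L2norm (V s) * m * expR (- (lam N * s)) * L^-1 * (expR (L * (tau - s)) - 1).
  move=> sI; move: (sI); rewrite in_itv/= => /andP[ts stau].
  have s0 := le_trans t0 ts.
  have lhsI := ae_integralN
    (@ae_integral_sum _ s tau _ (index_iota 1 N.+1) _ _ (fun j _ =>
    ae_integralZ (dot (err t) (phi j) * expR (lam j * (s - t)))
      (ae_integral_dot (phi j) cerr s0))).
  apply: (ae_integral_le _ lhsI (ae_integralZ _ (ae_integral_expR L stau))) => x xI /=.
  have -> : \sum_(1 <= j < N.+1)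
      dot (err t) (phi j) * expR (lam j * (s - t)) * dot (err x) (phi j) = dot (err x) (V s).
    by rewrite dot_sumr; apply: eq_bigr => j _; rewrite dotZr.
  move: (xI); rewrite in_itv/= => /andP[sx xtau].
  have xI0 : x \in `[0, tau] by rewrite in_itv/= (le_trans s0).
  rewrite (le_trans (ler_norm _))// normrN (le_trans (dot_norm_le _ _))//.
  rewrite [leRHS](_ : _ = m * expR (L * (tau - x)) * expR (- (lam N * s)) * L2norm (V s)).
    rewrite ler_wpM2r ?L2norm_ge0// (le_trans (em x xI0))//.
    rewrite ler_wpM2l ?mulr_ge0 ?expR_ge0// ler_expR lerN2 ler_wpM2l// ltW//.
    exact: (lam_gt0 eig N_ge1).
  by field; rewrite gt_eqF.
(* One factor |P| is cancelled; when it is 0 the claim is just [0 <= X]. *)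
suff : L2norm P ^+ 2 <= L2norm P * X.
  have [->|Pn0] := eqVneq (L2norm P) 0.
    rewrite !mulr_ge0 ?expR_ge0// subr_ge0 -[leLHS]expR0 ler_expR.
    by rewrite mulr_ge0 ?subr_ge0// ltW.
  by rewrite expr2 ler_pM2l// lt_neqAle eq_sym Pn0 L2norm_ge0.
have mainI : ae_integral t tau (fun s => \sum_(1 <= j < N.+1) - dot (err t) (phi j) *
    (expR (lam j * (s - t)) * (dot (F s (u s) - F s (uN s)) (phi j) +
       \int[leb]_(x in `[s, tau]) dot (err x) (phi j)))) (L2norm P ^+ 2).
  rewrite (sqr_L2norm_sum eig).
  rewrite (eq_bigr (fun j => - dot (err t) (phi j) * - dot (err t) (phi j))); last first.
    by move=> j _; rewrite mulrNN expr2.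
  apply: ae_integral_sum => j; rewrite mem_index_iota ltnS => jN.
  by apply: ae_integralZ; exact: error_dot_low.
rewrite [leRHS](_ : _ = L2norm P * m * expR (- (lam N * t)) * (expR (L * (tau - t)) - 1)).
  apply: (ae_integral_le _ mainI (ae_integralZ _ (ae_integral_expR L ttau))) => s sI.
  have sI0 := sub_itv t0 sI.
  have -> : \sum_(1 <= j < N.+1) - dot (err t) (phi j) *
      (expR (lam j * (s - t)) * (dot (F s (u s) - F s (uN s)) (phi j) +
         \int[leb]_(x in `[s, tau]) dot (err x) (phi j))) =
      - dot (F s (u s) - F s (uN s)) (V s) +
      - \sum_(1 <= j < N.+1) dot (err t) (phi j) * expR (lam j * (s - t)) *
        \int[leb]_(x in `[s, tau]) dot (err x) (phi j).
    rewrite dot_sumr -!sumrN -big_split/=; apply: eq_bigr => j _.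
    by rewrite dotZr; ring.
  have VF : - dot (F s (u s) - F s (uN s)) (V s) <=
      kappa * (L2norm (V s) * m * expR (- (lam N * s))) * expR (L * (tau - s)).
    rewrite (le_trans (ler_norm _))// normrN (le_trans (dot_norm_le _ _))//.
    rewrite [leRHS](_ : _ = kappa * (m * expR (L * (tau - s)) * expR (- (lam N * s))) *
      L2norm (V s)); last by ring.
    rewrite ler_wpM2r ?L2norm_ge0// (le_trans (F_lip sI0 _ _))//.
    by rewrite ler_wpM2l ?em// ltW.
  apply: (le_trans (lerD VF (tailI s sI))).
  set Q := L2norm (V s) * m * expR (- (lam N * s)).
  (* The growth e^(lam_N (s - t)) of [V s] against the weight e^(-lam_N s) leaves e^(-lam_N t),
     independent of [s]. *)
  have QP : Q <= L2norm P * m * expR (- (lam N * t)).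
    rewrite [leRHS](_ : _ = expR (lam N * (s - t)) * L2norm P * m * expR (- (lam N * s))).
      by rewrite !ler_wpM2r ?expR_ge0// VP.
    rewrite (_ : - (lam N * t) = lam N * (s - t) - lam N * s); last by ring.
    by rewrite expRD; ring.
  have Q0 : 0 <= Q by rewrite !mulr_ge0 ?expR_ge0 ?L2norm_ge0.
  have El := expR_ge0 (L * (tau - s)).
  have Li : L^-1 <= 1 by rewrite invf_le1.
  have Li0 : 0 <= L^-1 by rewrite invr_ge0 ltW.
  (* The source contributes the factor kappa and the memory term at most 1 / L. Since kappa + 1 / L
     <= kappa + 1 <= L, the integrand is below [Q] times the function with the exact integral e^(L
     (tau - t)) - 1. *)
  apply: (@le_trans _ _ (Q * (L * expR (L * (tau - s))))); last first.
    by rewrite ler_wpM2r// mulr_ge0// ltW.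
  rewrite -subr_ge0 [leRHS](_ : _ =
    Q * ((L - kappa - L^-1) * expR (L * (tau - s)) + L^-1)); last by ring.
  rewrite mulr_ge0// addr_ge0// mulr_ge0// -addrA -opprD subr_ge0.
  by rewrite (le_trans _ kL)// lerD2l.
by rewrite /X; ring.
Qed.

Lemma truncation_error_le (a b : R) : 0 <= a -> tau <= b ->
  Linfty_gevrey tau lam phi a b u -> forall t, t \in `[0, tau] ->
  L2norm (u t - uN t) <= expR ((1 + Num.max kappa 1) * (tau - t))
    * fine (Linfty_gevrey_norm tau lam phi a b u)
    * lam N `^ (- a) * expR (- ((b - tau + t) * lam N)).
Proof.
move=> a0 taub [_ uGoo]; set L := 1 + _; set M := fine _.
have b0 : 0 <= b by rewrite (le_trans _ taub)// ltW.
have kL : kappa + 1 <= L by rewrite addrC lerD2l le_max lexx.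
have L1 : 1 <= L by rewrite lerDl le_max ler01 orbT.
have lamN0 : 0 < lam N := lam_gt0 eig N_ge1.
(* Positive length of [0, tau] matters here: for the zero measure the essential supremum would be
   -oo. *)
have uG0 : (0 <= Linfty_gevrey_norm tau lam phi a b u)%E.
  apply: ess_sup_gee; last by apply: aeW => t; exact: poweR_ge0.
  rewrite [ltRHS](_ : _ = lebesgue_measure ([set: R] `&` `[0, tau]%classic))//.
  by rewrite setTI lebesgue_measure_itv/= lte_fin tau_gt0 -EFinD lte_fin subr0.
have uGM : Linfty_gevrey_norm tau lam phi a b u = M%:E by rewrite fineK// ge0_fin_numE.
have M0 : 0 <= M by exact: fine_ge0.
have uM : {ae leb, forall t, `[0, tau]%classic t ->
    (gevrey_norm lam phi a b (u t) <= M%:E)%E}.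
  by apply: ae_itv_measure; rewrite -uGM; exact: ess_sup_ge.
pose T := M * lam N `^ (- a) * expR (- (b * lam N)).
have T0 : 0 <= T by rewrite !mulr_ge0 ?powR_ge0 ?expR_ge0.
pose P t := \sum_(1 <= j < N.+1) dot (err t) (phi j) *: phi j.
(* Parseval splits the squared error at mode [N]. Above [N] the coefficients are those of [u], with
   tail at most [T ^+ 2]; then P^2 + T^2 <= (P + T)^2. *)
have errPT t : t \in `[0, tau] -> (gevrey_norm lam phi a b (u t) <= M%:E)%E ->
    L2norm (err t) <= L2norm (P t) + T.
  move=> tI uMt; rewrite -(@ler_pXn2r _ 2) ?nnegrE ?addr_ge0 ?L2norm_ge0//.
  apply: (@le_trans _ _ (L2norm (P t) ^+ 2 + T ^+ 2)); last first.
    by rewrite sqrrD -addrA lerD2l lerDr mulrn_wge0// mulr_ge0// L2norm_ge0.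
  have errN := parseval eig (f := err t).
  apply: (cvgr_to_le errN).
  exists N => // n /= Nn.
  rewrite (@big_cat_nat _ _ _ N.+1)//= (sqr_L2norm_sum eig) lerD2l.
  rewrite (eq_big_nat _ _ (F2 := fun j => dot (u t) (phi j) ^+ 2)).
    exact: (gevrey_tail eig n a0 b0 N_ge1 M0 uMt).
  by move=> j /andP[Nj _]; rewrite dotBl truncated_solution_dot_high// subr0.
have cK k : {within `[0, tau], continuous (fun t => expR (k * (t - tau)))}.
  by apply: continuous_subspaceT; exact: continuous_kernel.
(* Normalized at [tau], the weight is at most 1 on [0, tau], so the tail still contributes at most
   [T]. Undoing it at the end turns e^(-b lam_N) into e^(-(b - tau + t) lam_N). *)
pose w t := L2norm (err t) * expR (lam N * (t - tau)).
have cw : {within `[0, tau], continuous w}.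
  move=> t; apply: cvgM; first exact: (continuous_L2_norm cerr).
  exact: cK.
pose E t := expR (- L * (t - tau)).
have cE : {within `[0, tau], continuous E}.
  exact: cK.
have [t0 t0I maxm] : exists2 t0, t0 \in `[0, tau] &
    forall t, t \in `[0, tau] ->
      w t * expR (L * (t - tau)) <= w t0 * expR (L * (t0 - tau)).
  apply: (EVT_max (f := fun t => w t * expR (L * (t - tau)))); first exact: ltW.
  move=> t; apply: cvgM; first exact: cw.
  exact: cK.
set m := w t0 * _ in maxm.
have EK t : expR (L * (t - tau)) * E t = 1.
  by rewrite /E -expRD -mulrDl subrr mul0r expR0.
have m0 : 0 <= m by rewrite !mulr_ge0 ?L2norm_ge0 ?expR_ge0.
have wm t : t \in `[0, tau] -> w t <= m * E t.
  move=> tI; rewrite -[w t]mulr1 -(EK t) mulrA.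
  by rewrite ler_wpM2r ?expR_ge0 ?maxm.
have ELE t : E t = expR (L * (tau - t)) by congr expR; ring.
have lowm t : t \in `[0, tau] -> L2norm (P t) * expR (lam N * (t - tau)) <= m * (E t - 1).
  move=> tI.
  (* The factor e^(lam_N tau) converts this normalization to the weight e^(-lam_N s) of
     [low_error_le]. *)
  have em s : s \in `[0, tau] -> L2norm (err s) <=
      m * expR (lam N * tau) * expR (L * (tau - s)) * expR (- (lam N * s)).
    move=> sI; rewrite -ELE [leRHS](_ : _ = m * E s * expR (- (lam N * (s - tau)))).
      by rewrite -ler_pdivrMr ?expR_gt0// -expRN opprK; exact: wm.
    rewrite (_ : - (lam N * (s - tau)) = lam N * tau - lam N * s); last by ring.
    by rewrite expRD; ring.
  have me0 : 0 <= m * expR (lam N * tau) by rewrite mulr_ge0 ?expR_ge0.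
  have := low_error_le me0 L1 kL em tI; rewrite -/(P t) -ELE => PE.
  rewrite -ler_pdivlMr ?expR_gt0// (le_trans PE)// -expRN.
  rewrite (_ : - (lam N * (t - tau)) = lam N * tau - lam N * t); last by ring.
  by rewrite expRD le_eqVlt; apply/orP; left; apply/eqP; ring.
have mT : m <= T.
  have : w t0 - m * (E t0 - 1) <= T.
    apply: (ae_le_continuous (f := fun t => w t - m * (E t - 1)) tau_gt0 _ _ t0I).
      move=> t; apply: cvgB; first exact: cw.
      by apply: cvgMr; apply: cvgB; [exact: cE|exact: cvg_cst].
    apply: (@filterS _ _ (ae_filter_ringOfSetsType leb) _ _ _ uM) => t + tI.
    move=> /(_ tI) uMt; rewrite lerBlDr addrC.
    apply: (@le_trans _ _ ((L2norm (P t) + T) * expR (lam N * (t - tau)))).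
      by rewrite ler_wpM2r ?expR_ge0// errPT.
    rewrite mulrDl lerD ?lowm// -[leRHS]mulr1 ler_wpM2l//.
    rewrite -[leRHS]expR0 ler_expR pmulr_rle0// subr_le0.
    by move: tI; rewrite /= in_itv/= => /andP[].
  (* At the maximum point the left-hand side collapses to [m]. *)
  rewrite (_ : w t0 = m * E t0); last by rewrite /m -mulrA EK mulr1.
  by rewrite mulrBr mulr1 opprB addrC subrK.
move=> t tI; rewrite [leRHS](_ : _ = T * E t * expR (- (lam N * (t - tau)))).
  rewrite -ler_pdivrMr ?expR_gt0// -expRN opprK (le_trans (wm t tI))//.
  by rewrite ler_wpM2r ?expR_ge0.
rewrite /T ELE.
rewrite (_ : - ((b - tau + t) * lam N) = - (b * lam N) - lam N * (t - tau)); last by ring.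
by rewrite expRD; ring.
Qed.

End truncation_error.

Theorem theorem4p1 (R : realType) (d : nat) (d_ge1 : (1 <= d)%N)
    (Omega : @smooth_domain R d) (tau : R) (tau_gt0 : 0 < tau)
    (lam : nat -> R) (phi : nat -> L2 Omega)
    (eig : dirichlet_eigensystem lam phi)
    (F : R -> L2 Omega -> L2 Omega) (kappa : R) (kappa_gt0 : 0 < kappa)
    (F_lip : lipschitz_source tau kappa F)
    (phi0 : L2 Omega) (F_L1 : L2integrable 0 tau (fun s => F s phi0))
    (g : L2 Omega) (u : R -> L2 Omega)
    (u_sol : fvp_unique_solution tau F g u)
    (u_coef : coefficient_formula tau lam phi F g u)
    (p q : R) (p_gt0 : 0 < p) (q_gt0 : 0 < q)
    (N : nat) (N_ge1 : (1 <= N)%N) (uN : R -> L2 Omega)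
    (uN_sol : truncated_solution tau lam phi F g N uN) :
  let kappa0 := Num.max kappa 1 in
  (Linfty_gevrey tau lam phi p tau u ->
   forall t, t \in `[0, tau] ->
     L2norm (u t - uN t) <=
       expR ((1 + kappa0) * (tau - t))
       * fine (Linfty_gevrey_norm tau lam phi p tau u)
       * lam N `^ (- p) * expR (- (lam N * t))) /\
  (Linfty_gevrey tau lam phi 0 (q + tau) u ->
   forall t, t \in `[0, tau] ->
     L2norm (u t - uN t) <=
       expR ((1 + kappa0) * (tau - t))
       * fine (Linfty_gevrey_norm tau lam phi 0 (q + tau) u)
       * expR (- ((q + t) * lam N))).
Proof.
move=> kappa0; have [fvp _] := u_sol; have tau0 := ltW tau_gt0.
have err_le := truncation_error_le tau_gt0 eig kappa_gt0 F_lip fvp u_coef N_ge1 uN_sol.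
split=> uG t tI.
  (* Case (i) is [a = p], [b = tau], where the exponent b - tau + t is t. *)
  have := err_le _ _ (ltW p_gt0) (lexx _) uG t tI.
  by rewrite subrr add0r [t * _]mulrC.
(* Case (ii) is [a = 0], [b = q + tau]: the exponent becomes q + t and the power of lam_N is 1. *)
have := err_le _ _ (lexx _) _ uG t tI.
rewrite lerDr (ltW q_gt0) addrK oppr0 powRr0 mulr1; exact.
Qed.
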